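(* For every integer $n\geq 45$, we have $\mathrm{CRT}_W(n)=\mathrm{RT}(n)=\frac{n}{n-1}$.
   Context: Let $A_n=\{1,2,\dots,n\}$ be an alphabet of $n$ letters. For a word $w=w_1\cdots w_k$, a positive integer $p$ is a period of $w$ if $w_{i+p}=w_i$ for all $1\leq i\leq k-p$; the exponent of $w$ is the largest value of $|w|/p$ over periods $p$ of $w$. For a real $r>1$, a (linear) word is $r$-free if it has no factor of exponent $\geq r$. Two words $x,y$ are conjugates if $x=uv$, $y=vu$ for some words $u,v$. The circular word $\langle w\rangle$ is the set of all conjugates of $w$; a factor of $\langle w\rangle$ is a factor of some conjugate of $w$, and $\langle w\rangle$ is $r$-free if it has no factor of exponent $\geq r$. The repetition threshold is $\mathrm{RT}(n)=\inf\{r>1 : \text{there are arbitrarily long } r\text{-free words over } A_n\}$, and the weak circular repetition threshold is $\mathrm{CRT}_W(n)=\inf\{r>1 : \text{there are arbitrarily long } r\text{-free circular words over } A_n\}$. *)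

(* Defs.v *)
From mathcomp Require Import all_boot all_order all_algebra.
From mathcomp Require Import all_classical all_reals.

Set Implicit Arguments.
Unset Strict Implicit.
Unset Printing Implicit Defensive.

Import Order.TTheory GRing.Theory Num.Theory.

Local Open Scope classical_set_scope.
Local Open Scope ring_scope.

Section Words.
Variable T : eqType.
Implicit Types (w u x y : seq T) (p : nat).

(* Positions are counted from 0, so that 1 <= i <= k - p becomes i + p < k;
   every p >= size w is a period. *)
Definition period w p : Prop :=
  (0 < p)%N /\ forall i, (i + p < size w)%N -> onth w (i + p) = onth w i.

Definition conjugate x y : Prop := exists u v, x = u ++ v /\ y = v ++ u.

Definition circular_word w : set (seq T) := [set x | conjugate w x].

Definition circular_factor (C : set (seq T)) u : Prop :=
  exists2 x, C x & infix u x.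

Variable R : realType.

(* The supremum is a maximum: see exponent_max. *)
Definition exponent w : R :=
  sup [set (size w)%:R / p%:R | p in period w].

Definition word_free (r : R) w : Prop :=
  forall u, infix u w -> ~ r <= exponent u.

Definition circular_free (r : R) (C : set (seq T)) : Prop :=
  forall u, circular_factor C u -> ~ r <= exponent u.

Lemma exponent_max w :
  (exists2 p, period w p & exponent w = (size w)%:R / p%:R) /\
  (forall p, period w p -> (size w)%:R / p%:R <= exponent w).
Proof.
have ex : exists p, `[< period w p >].
  exists (size w).+1; apply/asboolP; split=> // i.
  by rewrite ltnNge addnS ltnW // ltnS leq_addl.
case: (ex_minnP ex) => m /asboolP wm minm.
have ub p : period w p -> (size w)%:R / p%:R <= (size w)%:R / m%:R :> R.
  move=> wp; apply: ler_wpM2l; first exact: ler0n.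
  rewrite lef_pV2 ?posrE ?ltr0n ?wm.1 ?wp.1 // ler_nat.
  by apply: minm; apply/asboolP.
suff -> : exponent w = (size w)%:R / m%:R by split=> //; exists m.
apply/eqP; rewrite eq_le; apply/andP; split.
  apply: ge_sup; first by exists ((size w)%:R / m%:R), m.
  by move=> _ [p wp <-]; exact: ub.
apply: ub_le_sup; last by exists m.
by exists ((size w)%:R / m%:R) => _ [p wp <-]; exact: ub.
Qed.

End Words.

(* The alphabet of n letters is 'I_n. Both sets below are bounded below by 1,
   and inf set0 = 0, so an infimum > 1 is a genuine infimum of a nonempty set. *)
Definition RT (R : realType) (n : nat) : R :=
  inf [set r : R | 1 < r /\
    forall N : nat, exists w : seq 'I_n, (N <= size w)%N /\ word_free r w].

Definition CRT_W (R : realType) (n : nat) : R :=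
  inf [set r : R | 1 < r /\
    forall N : nat, exists w : seq 'I_n,
      (N <= size w)%N /\ circular_free r (circular_word w)].

(* Main.v *)
(** The lower bound holds because a word over [n] letters either repeats a letter at
    distance less than [n] or has period [n].

    For the upper bound put [N = n - 1] and [l = n / 2], and write a word in rows of
    [N] cells. In the basic pattern the letters of odd cells stay in their column,
    while those of even cells, together with one waiting letter, form a conveyor
    that advances by one even cell per row; the pattern has period [l + 1] rows, a
    block. At the start of a block some of [m = (N - 2) / 6] disjoint 4-cycles
    ("sites", as in Carpi's work on Dejean's conjecture) permute the roles of two
    static and two conveyor letters. A factor that repeats too soon must then repeat
    at a whole number [q] of blocks, and each site seen by the factor must have
    turned a multiple of 4 times in between. Two sites turning at every block force
    [4 | q]; sites turning every 4, 16, 64, ... blocks force [q] to be a multiple of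
    [4 ^ (m - 2)]. The last site carries a cyclic binary word in which no factor
    occurs twice at a moderate distance that is a multiple of [4 ^ (m - 2) / 2]; such
    words exist by a counting argument. All words are periodic sequences, so the
    construction is circular from the outset. *)
Require Import Defs.
From mathcomp Require Import all_boot all_order all_algebra.
From mathcomp Require Import zify lra.

Set Implicit Arguments.
Unset Strict Implicit.
Unset Printing Implicit Defensive.

Import Order.TTheory GRing.Theory Num.Theory.

(** * Avoiding repetitions of arcs in a cyclic binary word *)

Section Counting.
Local Open Scope ring_scope.
Variables (R : realFieldType) (T I : finType) (P : pred I) (A : I -> {set T}) (f : I -> T -> T).

Definition matches (y : {ffun T -> bool}) w := [forall (x | x \in A w), y x == y (f w x)].

Definition scope w := A w :|: f w @: A w.

(** Values outside [S] are pinned to [false], so that colorings of different sets live in one type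
    and can be counted against each other. *)
Definition colorings (S : {set T}) : {set {ffun T -> bool}} :=
  [set y : {ffun T -> bool} | [forall (x | x \notin S), ~~ y x] &&
           [forall (w | P w && (scope w \subset S)), ~~ matches y w]].

Hypothesis fA : forall w x, P w -> x \in A w -> f w x \notin A w.
Hypothesis A0 : forall w, P w -> A w != set0.
Hypothesis f_sym : forall w v, P w -> v \in f w @: A w ->
  exists w', [/\ P w', v \in A w', scope w' = scope w &
                 forall y, matches y w -> matches y w'].
Implicit Types (S : {set T}) (y z : {ffun T -> bool}).
(** The constants balance: growth by [7 / 4 = 2 - 1 / 4] per point costs a factor [4 / 7] for each
    point taken away, and [A w] takes only [#|A w|.-1] old points besides [v]. *)
Hypothesis light : forall v,
  \sum_(w | P w && (v \in A w)) (4 / 7 : R) ^+ #|A w|.-1 <= 1 / 4.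

Definition erase (D : {set T}) (y : {ffun T -> bool}) : {ffun T -> bool} :=
  [ffun x => (x \notin D) && y x].

Lemma coloringsP (S : {set T}) (y : {ffun T -> bool}) :
  reflect ((forall x, x \notin S -> y x = false) /\
    forall w, P w -> scope w \subset S -> ~~ matches y w) (y \in colorings S).
Proof.
rewrite inE; apply: (iffP andP) => -[h1 h2]; split.
- by move=> x xS; apply/negbTE; apply: (implyP (forallP h1 x)).
- by move=> w Pw ws; apply: (implyP (forallP h2 w)); rewrite Pw.
- by apply/forallP=> x; apply/implyP => /h1 ->.
- by apply/forallP=> w; apply/implyP => /andP[]; exact: h2.
Qed.

Lemma eq_matches (y z : {ffun T -> bool}) w : (forall x, x \in scope w -> y x = z x) ->
  matches y w = matches z w.
Proof.
move=> yz; apply: eq_forallb => x; case: (boolP (x \in A w)) => //= xA.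
by rewrite !yz // inE ?xA // imset_f ?orbT.
Qed.

Lemma erase_colorings (S D : {set T}) y : y \in colorings S ->
  erase D y \in colorings (S :\: D).
Proof.
case/coloringsP=> h1 h2; apply/coloringsP; split=> [x|w Pw ws].
  by rewrite inE negb_and negbK ffunE => /orP[->//|/h1 ->]; rewrite andbF.
rewrite (@eq_matches _ y) ?h2 //; first by apply: subset_trans ws (subsetDl _ _).
by move=> x /(subsetP ws); rewrite inE ffunE => /andP[->].
Qed.

(** A match copies the values on [A w] from their images, which lie outside [A w] by [fA] and so
    survive the erasure. *)
Lemma erase_matches_inj w y z : P w -> matches y w -> matches z w ->
  erase (A w) y = erase (A w) z -> y = z.
Proof.
move=> Pw /forallP yw /forallP zw /ffunP E; apply/ffunP=> x.
case: (boolP (x \in A w)) => xA; last by have := E x; rewrite !ffunE xA.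
have /eqP -> := implyP (yw x) xA; have /eqP -> := implyP (zw x) xA.
by have := E (f w x); rewrite !ffunE fA.
Qed.

Definition extensions (v : T) (S : {set T}) : {set {ffun T -> bool}} :=
  [set y : {ffun T -> bool} | erase [set v] y \in colorings S &
    [forall (x | x \notin v |: S), ~~ y x]].

Lemma card_extensions v S : v \notin S -> (2 * #|colorings S| <= #|extensions v S|)%N.
Proof.
move=> vS.
pose paint (u : bool * {ffun T -> bool}) : {ffun T -> bool} :=
  [ffun x => if x == v then u.1 else u.2 x].
have eraseK u : u.2 \in colorings S -> erase [set v] (paint u) = u.2.
  case/coloringsP=> h _; apply/ffunP=> x; rewrite !ffunE inE.
  by case: eqP => [->|//]; rewrite h.
rewrite -card_bool -cardsT -cardsX -(@card_in_imset _ _ paint).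
  apply: subset_leq_card; apply/subsetP=> _ /imsetP[[b y] /setXP[_ uS] ->].
  rewrite inE eraseK // uS; apply/forallP=> x; apply/implyP.
  case/coloringsP: uS => h _; rewrite !inE negb_or ffunE => /andP[/negbTE -> /h ->//].
move=> [b y] [b' y'] /setXP[_ uS] /setXP[_ uS'] E.
have := eraseK (b, y) uS; have := eraseK (b', y') uS'; rewrite E /= => -> ->.
by have /ffunP/(_ v) := E; rewrite !ffunE eqxx /= => ->.
Qed.

Lemma bad_extensions v S w : v \notin S -> P w -> v \in A w ->
  (#|[set y in extensions v S | matches y w]| <= #|colorings (S :\: A w)|)%N.
Proof.
move=> vS Pw vA; rewrite -(@card_in_imset _ _ (erase (A w))); last first.
  by move=> y z; rewrite !inE => /andP[_ yw] /andP[_ zw]; apply: erase_matches_inj yw zw.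
apply: subset_leq_card; apply/subsetP=> z /imsetP[y]; rewrite inE => /andP[].
rewrite inE => /andP[yS _] _ ->.
have -> : erase (A w) y = erase (A w) (erase [set v] y).
  apply/ffunP=> x; rewrite !ffunE inE; case: eqP => [->|//]; by rewrite vA.
exact: erase_colorings.
Qed.

(** A match inside [v |: S] must involve [v]. If [v] is only an image, [f_sym] trades [w] for a
    constraint that has [v] in its source. *)
Lemma good_extension v S y : y \in extensions v S ->
  (forall w, P w -> v \in A w -> scope w \subset v |: S -> ~~ matches y w) ->
  y \in colorings (v |: S).
Proof.
rewrite inE => /andP[/coloringsP[h1 h2] /forallP h3] good.
apply/coloringsP; split=> [x xS|w Pw ws].
  by apply/negbTE; apply: (implyP (h3 x)).
case: (boolP (v \in A w)) => vA; first exact: good.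
case: (boolP (v \in f w @: A w)) => vfA.
  have [w' [Pw' vA' sw' mw']] := f_sym Pw vfA.
  by apply: contra (mw' y) _; apply: good; rewrite ?sw'.
have vs x : x \in scope w -> (x \in S) && (x != v).
  move=> xs; have xv : x != v.
    by apply: contraL xs => /eqP ->; rewrite inE negb_or vA.
  by move/subsetP/(_ x xs): ws; rewrite !inE (negbTE xv) /= => ->.
rewrite -(@eq_matches (erase [set v] y)); last first.
  by move=> x /vs/andP[_ xv]; rewrite ffunE inE xv.
by apply: h2 => //; apply/subsetP=> x /vs/andP[].
Qed.

(* Rosenfeld's counting argument: every extension of a coloring of [S] to [v |: S]
   that fails matches some [A w] containing [v], hence is determined by its
   restriction to [S :\: A w]. *)
Lemma colorings_grow S v : v \notin S ->
  7 / 4 * #|colorings S|%:R <= #|colorings (v |: S)|%:R :> R.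
Proof.
have [k] := ubnP #|S|; elim: k S v => [|k IH] S v; first by rewrite ltn0.
move=> Sk vS.
(* By the induction hypothesis each point of [D] that is removed divides the count by at least
   [7 / 4]. *)
have shrink (D : {set T}) : D \subset S ->
    #|colorings (S :\: D)|%:R <= (4 / 7) ^+ #|D| * #|colorings S|%:R :> R.
  have [j] := ubnP #|D|; elim: j D => [|j IHj] D; first by rewrite ltn0.
  move=> Dj DS.
  case: (set_0Vmem D) => [->|[x xD]]; first by rewrite setD0 cards0 mul1r.
  have xS := subsetP DS x xD.
  have cD : #|D| = #|D :\ x|.+1 by rewrite (cardsD1 x) xD.
  have Dj' : (#|D :\ x| < j)%N by rewrite -ltnS -cD.
  have h1 := IHj (D :\ x) Dj' (subset_trans (subsetDl _ _) DS).
  have h2 : S :\: (D :\ x) = x |: (S :\: D).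
    apply/setP=> z; rewrite !inE; case: eqP => [->|] //=; by rewrite xS.
  have h3 : 7 / 4 * #|colorings (S :\: D)|%:R <= #|colorings (x |: (S :\: D))|%:R :> R.
    apply: IH; last by rewrite inE xD.
    apply: (@leq_trans #|S|); last by rewrite -ltnS.
    apply: proper_card; apply/properP.
    by split; [exact: subsetDl|exists x; rewrite // inE xD].
  rewrite -h2 in h3; rewrite cD exprS.
  rewrite -mulrA; lra.
have bound : (2 * #|colorings S| <= #|colorings (v |: S)| +
    \sum_(w | P w && (v \in A w) && (scope w \subset v |: S))
      #|colorings (S :\: A w)|)%N.
  apply: leq_trans (card_extensions vS) _.
  pose bad w := [set y in extensions v S | matches y w].
  apply: (@leq_trans #|colorings (v |: S) :|:
    \bigcup_(w | P w && (v \in A w) && (scope w \subset v |: S)) bad w|).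
    apply: subset_leq_card; apply/subsetP=> y yE; rewrite inE.
    case: (boolP (y \in colorings _)) => //= ny.
    case: (boolP (y \in \bigcup_(_ | _) _)) => // nb; case/negP: ny.
    apply: good_extension => // w Pw vA ws; apply: contra nb => yw.
    by apply/bigcupP; exists w; rewrite ?Pw ?vA ?ws // inE yE.
  apply: leq_trans (leq_card_setU _ _) _; rewrite leq_add2l.
  apply: (@leq_trans (\sum_(w | P w && (v \in A w) && (scope w \subset v |: S)) #|bad w|)).
    elim/big_rec2: _ => [|w u V _ uV]; first by rewrite cards0.
    by apply: leq_trans (leq_card_setU _ _) _; rewrite leq_add2l.
  by apply: leq_sum => w /andP[/andP[Pw vA] _]; apply: bad_extensions.
have : \sum_(w | P w && (v \in A w) && (scope w \subset v |: S))
      #|colorings (S :\: A w)|%:R <= 1 / 4 * #|colorings S|%:R :> R.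
  apply: le_trans (ler_wpM2r (ler0n _ _) (light v)).
  rewrite mulr_suml big_mkcondr /=; apply: ler_sum => w /andP[Pw vA].
  case: ifP => ws; last by rewrite mulr_ge0 // exprn_ge0 //; lra.
  have sD : A w :\ v \subset S.
    apply/subsetP=> x; rewrite !inE => /andP[xv xA].
    by have := subsetP ws x; rewrite !inE xA (negbTE xv) /=; apply.
  have -> : S :\: A w = S :\: (A w :\ v).
    apply/setP=> x; rewrite !inE negb_and negbK.
    by case: eqP => [->|//]; rewrite (negbTE vS) andbF.
  have -> : (#|A w|.-1 = #|A w :\ v|)%N by rewrite (cardsD1 v (A w)) vA.
  exact: shrink.
move: bound; rewrite -(ler_nat R) natrM natrD natr_sum; lra.
Qed.

Lemma exists_coloring : exists y : {ffun T -> bool}, forall w, P w ->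
  exists2 x, x \in A w & y x != y (f w x).
Proof.
have pos S : (0 < #|colorings S|)%N.
  have [k] := ubnP #|S|; elim: k S => [|k IH] S; first by rewrite ltn0.
  move=> Sk.
  case: (set_0Vmem S) => [->|[v vS]].
    apply/card_gt0P; exists [ffun=> false]; apply/coloringsP; split=> [x _|w Pw].
      by rewrite ffunE.
    by rewrite subset0 setU_eq0 (negbTE (A0 Pw)).
  have h : (0 < #|colorings (S :\ v)|)%N.
    by apply: IH; move: Sk; rewrite (cardsD1 v) vS.
  have := @colorings_grow (S :\ v) v; rewrite setD1K // !inE eqxx => /(_ isT).
  move: h; rewrite -!(ltr_nat R); lra.
have /card_gt0P[y /coloringsP[_ yP]] := pos setT; exists y => w Pw.
have := yP w Pw (subsetT _); rewrite negb_forall => /existsP[x].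
by rewrite negb_imply => /andP[xA xy]; exists x.
Qed.
End Counting.

(** * Arcs of a cycle of length H and their shifts by multiples of Q *)

Section Noise.
Variables (Q H : nat).
Hypotheses (H0 : 0 < H) (Q9 : 9 <= Q).

Let pos i : 'I_H := Ordinal (ltn_pmod i H0).
(** The index [(e, (o, i))] stands for the two arcs of length [9 * e] at [i] and [i + e * Q]; [o]
    tells which of them is the source. The bound in [legal] keeps them disjoint around the cycle. *)
Let index := ('I_H.+1 * (bool * 'I_H))%type.

Let legal (w : index) := (0 < w.1) && (w.1 * (Q + 9) <= H).
Let start (w : index) := if w.2.1 then w.2.2 : nat else w.2.2 + w.1 * Q.
Let jump (w : index) := if w.2.1 then w.1 * Q else H - w.1 * Q.
Let arc (w : index) := [set pos (start w + r) | r : 'I_(9 * w.1)].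
Let copy (w : index) (x : 'I_H) := pos (x + jump w).
Let opposite (w : index) : index := (w.1, (~~ w.2.1, w.2.2)).

Lemma posE i j : (pos i == pos j) = (i == j %[mod H]).
Proof. by []. Qed.

Lemma copy_pos w i : copy w (pos i) = pos (i + jump w).
Proof. by apply/eqP; rewrite posE /= modnDml. Qed.

Lemma jump_bounds w : legal w ->
  9 * w.1 <= jump w /\ jump w + 9 * w.1 <= H.
Proof. by case/andP=> e0 eH; rewrite /jump; case: ifP => _; nia. Qed.

Lemma copy_notin w x : legal w -> x \in arc w -> copy w x \notin arc w.
Proof.
move=> lw /imsetP[r _ ->]; have [j1 j2] := jump_bounds lw.
apply/imsetP=> -[r' _]; rewrite copy_pos => /eqP; rewrite posE -addnA eqn_modDl.
have := ltn_ord r; have := ltn_ord r' => h h'.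
by rewrite !modn_small; lia.
Qed.

Lemma copy_oppositeK w x : legal w -> copy (opposite w) (copy w x) = x.
Proof.
case: w => e [o i] /andP[/= e0 eH]; apply/val_inj; rewrite /copy /= modnDml -addnA.
have -> : jump (e, (o, i)) + jump (opposite (e, (o, i))) = H.
  by rewrite /jump /=; case: o => /=; nia.
by rewrite modnDr modn_small.
Qed.

Lemma copy_arc w : legal w -> copy w @: arc w = arc (opposite w).
Proof.
move=> lw; have E (r : 'I_(9 * w.1)) : copy w (pos (start w + r)) = pos (start (opposite w) + r).
  rewrite copy_pos; case: w lw r => e [o i] /andP[/= e0 eH] r.
  apply/eqP; rewrite posE /start /jump /=; case: o => /=; first by rewrite addnAC.
  have -> : i + e * Q + r + (H - e * Q) = i + r + H by nia.
  by rewrite modnDr.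
apply/setP=> x; apply/imsetP/imsetP.
  by case=> _ /imsetP[r _ ->] ->; exists r.
case=> r _ ->; exists (pos (start w + r)); last by rewrite E.
by apply/imsetP; exists r.
Qed.

Lemma oppositeK w : opposite (opposite w) = w.
Proof. by case: w => e [o i]; rewrite /opposite /= negbK. Qed.

Lemma scope_opposite w : legal w -> scope arc copy (opposite w) = scope arc copy w.
Proof. by move=> lw; rewrite /scope (copy_arc lw) copy_arc // oppositeK setUC. Qed.

Lemma card_arc w : legal w -> #|arc w| = 9 * w.1.
Proof.
move=> lw; rewrite card_imset ?card_ord // => r r' /eqP.
rewrite posE eqn_modDl; have [j1 j2] := jump_bounds lw.
have := ltn_ord r; have := ltn_ord r' => h h'.
by rewrite !modn_small; try lia; move/eqP/val_inj.
Qed.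

Lemma card_arcs_through (e : 'I_H.+1) (v : 'I_H) o : legal (e, (o, v)) ->
  #|[set i | v \in arc (e, (o, i))]| <= 9 * e.
Proof.
move=> lw; have [j1 j2] := jump_bounds lw; have /andP[/= e0 eH] := lw.
pose off := if o then 0 else e * Q.
(* The start of an arc is determined by the offset of [v] in it; [2 * H] keeps the subtraction
   exact. *)
pose back (r : 'I_(9 * e)) := pos (v + 2 * H - (r + off)).
rewrite -[X in _ <= X]card_ord -[X in _ <= X]cardsT.
apply: leq_trans (leq_imset_card back _); apply: subset_leq_card.
apply/subsetP=> i; rewrite inE => /imsetP[r _ vE]; apply/imsetP; exists r => //.
have rl := ltn_ord r; have offH : off <= H by rewrite /off; case: ifP => _; nia.
apply/eqP; rewrite -val_eqE /= -(@modn_small i H) // -(eqn_modDr (r + off)) subnK.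
  have -> : i + (r + off) = start (e, (o, i)) + r by rewrite /start /off /=; case: ifP => _; lia.
  have mod2 a : (a %% H + 2 * H) %% H = a %% H by rewrite -modnDmr modnMl addn0 modn_mod.
  by rewrite vE /= mod2.
by simpl in rl; nia.
Qed.

Local Open Scope ring_scope.

(** The factor [18 * e] counts two orientations times [9 * e] arcs through a point, and the
    subtracted term is the slack that closes the induction. Arcs of length [8 * e] would be too
    short: [16 * (4 / 7) ^+ 7] already exceeds [1 / 4]. *)
Lemma light_series (R : realFieldType) M :
  \sum_(e < M.+2 | (0 < e)%N) 18 * e%:R * (4 / 7 : R) ^+ (9 * e).-1 <=
    1 / 4 - M.+2%:R * (4 / 7) ^+ (9 * M.+1).
Proof.
have x9 : (4 / 7 : R) ^+ 9 <= 13 / 2000 by lra.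
elim: M => [|M IH].
  rewrite big_mkcond !big_ord_recr big_ord0 /= !add0r mulr1.
  lra.
rewrite big_mkcond big_ord_recr -big_mkcond
  [X in _ + X <= _](_ : _ = 18 * M.+2%:R * (4 / 7) ^+ (9 * M.+2).-1) //.
apply: le_trans (lerD IH (lexx _)) _.
have -> : (9 * M.+2).-1 = (9 * M.+1 + 8)%N by lia.
have -> : (9 * M.+2 = 9 * M.+1 + 9)%N by lia.
rewrite !exprD; set z := _ ^+ (9 * M.+1).
have z0 : 0 <= z by rewrite exprn_ge0 //; lra.
have -> : (4 / 7 : R) ^+ 8 = 7 / 4 * (4 / 7) ^+ 9 by lra.
move: x9; set x := _ ^+ 9 => x9.
have -> : M.+3%:R = M.+2%:R + 1 :> R by rewrite -[in LHS]addn1 natrD.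
have M2 : 1 <= M.+2%:R :> R by rewrite ler1n.
move: (M.+2%:R : R) M2 => k k1.
suff : z * (1 * k - (k + 1) * x - 18 * k * (7 / 4) * x) >= 0 by lra.
by apply: mulr_ge0 => //; nra.
Qed.

Lemma arcs_light (R : realFieldType) (v : 'I_H) :
  \sum_(w | legal w && (v \in arc w)) (4 / 7 : R) ^+ #|arc w|.-1 <= 1 / 4.
Proof.
pose F (e : 'I_H.+1) (u : bool * 'I_H) : R :=
  if legal (e, u) && (v \in arc (e, u)) then (4 / 7) ^+ #|arc (e, u)|.-1 else 0.
have -> : \sum_(w | legal w && (v \in arc w)) (4 / 7 : R) ^+ #|arc w|.-1 =
    \sum_e \sum_o \sum_i F e (o, i).
  rewrite big_mkcond /=.
  under [RHS]eq_bigr do rewrite pair_bigA /=.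
  by rewrite pair_bigA /=; apply: eq_bigr => -[e [o i]].
apply: (@le_trans _ _ (\sum_(e < H.+1 | (0 < e)%N) 18 * e%:R * (4 / 7 : R) ^+ (9 * e).-1)).
  rewrite [leRHS]big_mkcond; apply: ler_sum => e _.
  (* Legality depends on [e] alone, so one index decides it for all. *)
  case: (boolP (legal (e, (true, v)))) => [le|nle]; last first.
    rewrite big1 => [|o _]; last by rewrite big1 // => i _; rewrite /F [legal _](negbTE nle).
    by case: ifP => // _; rewrite !mulr_ge0 ?exprn_ge0 //; lra.
  have -> : (0 < e)%N by case/andP: le.
  suff bound o : \sum_i F e (o, i) <= 9 * e%:R * (4 / 7 : R) ^+ (9 * e).-1.
    rewrite big_bool; apply: le_trans (lerD (bound true) (bound false)) _.
    by set z := _ ^+ _; lra.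
  have -> : \sum_i F e (o, i) =
      \sum_(i in [set i | v \in arc (e, (o, i))]) (4 / 7 : R) ^+ (9 * e).-1.
    rewrite [RHS]big_mkcond; apply: eq_bigr => i _.
    by rewrite /F inE card_arc // [legal _]le.
  rewrite sumr_const -[leLHS]mulr_natl; apply: ler_wpM2r.
    by rewrite exprn_ge0 //; lra.
  by rewrite -natrM ler_nat; apply: (@card_arcs_through e v o).
case: H H0 => // h _; apply: le_trans (light_series R h) _.
by rewrite gerBl mulr_ge0 // exprn_ge0 //; lra.
Qed.

Lemma exists_noise : exists y : nat -> bool, (forall i, y (i + H)%N = y i) /\
  forall i e, (0 < e)%N -> (e * (Q + 9) <= H)%N ->
    exists2 r, (r < 9 * e)%N & y (i + r)%N != y (i + r + e * Q)%N.
Proof.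
have ne w : legal w -> arc w != set0.
  by move=> lw; rewrite -card_gt0 card_arc //; case/andP: lw; lia.
have [||w v lw|v|y yP] := @exists_coloring rat _ _ legal arc copy.
- exact: copy_notin.
- exact: ne.
- rewrite copy_arc // => vA; exists (opposite w); split=> //.
    exact: scope_opposite.
  move=> y /forallP yw; apply/forallP=> x; apply/implyP.
  rewrite -copy_arc // => /imsetP[x' x'A ->].
  by rewrite copy_oppositeK // eq_sym; apply: (implyP (yw x')).
- exact: arcs_light.
exists (fun i => y (pos i)); split=> [i|i e e0 eH].
  by congr (y _); apply/eqP; rewrite posE modnDr.
have eH1 : (e < H.+1)%N by nia.
have lw : legal (Ordinal eH1, (true, pos i)) by rewrite /legal /= e0.
have [x /imsetP[r _ ->]] := yP _ lw; rewrite copy_pos => yr.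
have rl : (r < 9 * e)%N := ltn_ord r.
have E d : pos (i %% H + r + d) = pos (i + r + d).
  by apply/eqP; rewrite posE -!addnA modnDml.
exists r => //; move: yr; rewrite /start /jump /=.
by rewrite E -[(i %% H + r)%N]addn0 E addn0.
Qed.
End Noise.

(** * The carousel word and its repetitions *)

Section Carousel.
Variables (N l m : nat) (C : nat -> nat -> nat).

(* Row [s] of a block consists of [N] cells. Odd cells are static and hold the slot
   of the same number; even cells form a conveyor with [l.+1] slots, of index
   [c./2 - s] modulo [l.+1], and slot number twice the index. *)
Definition slot s c :=
  if odd c then c else if s * 2 <= c then c - s * 2 else c + l.+1 * 2 - s * 2.

(* Site [a < m] is the 4-cycle 6a+3 -> 6a+4 -> 6a+6 -> 6a+5 -> 6a+3 of slots;
   [flip] converts offsets into positions along the cycle. *)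
Definition flip r := if r == 2 then 3 else if r == 3 then 2 else r.

Definition mobile z := [&& 3 <= z, z <= 6 * m & (z - 3) %% 6 < 4].

Definition turn e z :=
  if mobile z then 6 * ((z - 3) %/ 6) + 3 + flip ((flip ((z - 3) %% 6) + e) %% 4)
  else z.

(* [C a b] is the number of turns made by site [a] up to block [b]. *)
Definition letter b z := turn (C ((z - 3) %/ 6) b) z.

Definition cell_letter g c := letter (g %/ l.+1) (slot (g %% l.+1) c).

Definition word t := cell_letter (t %/ N) (t %% N).

(** When site [a] turns once, a letter passes to the preceding slot of the 4-cycle; the digits in
    the constructors are its old and new offsets. *)
Variant turned a z z' : Prop :=
| Turned35 of z = 6 * a + 3 & z' = 6 * a + 5
| Turned43 of z = 6 * a + 4 & z' = 6 * a + 3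
| Turned56 of z = 6 * a + 5 & z' = 6 * a + 6
| Turned64 of z = 6 * a + 6 & z' = 6 * a + 4.

Variant slot_spec s c : nat -> Prop :=
| SlotStatic x of c = 2 * x + 1 : slot_spec s c (2 * x + 1)
| SlotLow x of c = 2 * x & s <= x : slot_spec s c (2 * (x - s))
| SlotHigh x of c = 2 * x & x < s : slot_spec s c (2 * (x + l.+1 - s)).

Lemma slotP s c : slot_spec s c (slot s c).
Proof.
rewrite /slot; have := odd_double_half c; case: (odd c) => /= cE.
  rewrite [X in slot_spec _ _ X](_ : c = 2 * c./2 + 1); last lia.
  by apply: SlotStatic; lia.
case: leqP => sc.
  rewrite [X in slot_spec _ _ X](_ : _ = 2 * (c./2 - s)); last lia.
  by apply: SlotLow; lia.
rewrite [X in slot_spec _ _ X](_ : _ = 2 * (c./2 + l.+1 - s)); last lia.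
by apply: SlotHigh; lia.
Qed.

Lemma mobileP z :
  reflect (exists a r, [/\ z = 6 * a + 3 + r, a < m & r < 4]) (mobile z).
Proof.
apply: (iffP idP) => [/and3P[h1 h2 h3]|[a [r [-> am r4]]]].
  exists ((z - 3) %/ 6), ((z - 3) %% 6); split=> //; lia.
by rewrite /mobile; lia.
Qed.

Lemma letter_site a r b : a < m -> r < 4 ->
  letter b (6 * a + 3 + r) = 6 * a + 3 + flip ((flip r + C a b) %% 4).
Proof.
move=> am r4; rewrite /letter /turn.
have -> : mobile (6 * a + 3 + r) by apply/mobileP; exists a, r.
have -> : (6 * a + 3 + r - 3) %/ 6 = a by lia.
by have -> : (6 * a + 3 + r - 3) %% 6 = r by lia.
Qed.

Lemma letter_fixed z b : ~~ mobile z -> letter b z = z.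
Proof. by rewrite /letter /turn => /negbTE ->. Qed.

Lemma flip_lt r : r < 4 -> flip r < 4.
Proof. by move: r => [|[|[|[|]]]]. Qed.

Lemma flip_inj r r' : flip r = flip r' -> r = r'.
Proof. by rewrite /flip; do !case: eqP; lia. Qed.

Lemma letter_eq b z b' z' : letter b z = letter b' z' ->
  (z = z' /\ ~~ mobile z) \/
  exists a r r', [/\ a < m, r < 4, r' < 4, z = 6 * a + 3 + r & z' = 6 * a + 3 + r']
    /\ flip r + C a b = flip r' + C a b' %[mod 4].
Proof.
have lt4 x : flip (x %% 4) < 4 by rewrite flip_lt // ltn_pmod.
case: (boolP (mobile z)) => mz; case: (boolP (mobile z')) => mz'.
- case/mobileP: mz => a [r [-> am r4]]; case/mobileP: mz' => a' [r' [-> am' r4']].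
  rewrite !letter_site // => E; right.
  have := lt4 (flip r + C a b); have := lt4 (flip r' + C a' b') => h1 h2.
  have ea : a' = a by lia.
  rewrite ea in E *; exists a, r, r'; split=> //; apply: flip_inj; lia.
- rewrite (letter_fixed _ mz') => E; case/negP: mz'.
  case/mobileP: mz E => a [r [-> am r4]]; rewrite letter_site // => <-.
  by apply/mobileP; eexists a, _.
- rewrite (letter_fixed _ mz) => E; case/negP: mz.
  case/mobileP: mz' E => a [r [-> am r4]]; rewrite letter_site // => ->.
  by apply/mobileP; eexists a, _.
- by rewrite !letter_fixed // => ->; left.
Qed.

Lemma letter_static a r b b' : a < m -> r < 4 ->
  letter b (6 * a + 3 + r) = letter b' (6 * a + 3 + r) -> C a b = C a b' %[mod 4].
Proof.
move=> am r4 /letter_eq[[_ /mobileP[]]|[a' [r1 [r2 [[h1 h2 h3 h4 h5] E]]]]].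
  by exists a, r.
have ea : a' = a by lia.
have er : r1 = r2 by lia.
by move: E; rewrite ea er => /eqP; rewrite eqn_modDl => /eqP.
Qed.

Lemma letter_inj b : injective (letter b).
Proof.
move=> z z' /letter_eq[[]//|[a [r [r' [[h1 h2 h3 -> ->] E]]]]].
move/eqP: E; rewrite eqn_modDr !modn_small ?flip_lt // => /eqP/flip_inj ->.
by [].
Qed.

Hypothesis C_step : forall a b, C a b.+1 = C a b \/ C a b.+1 = (C a b).+1.

Lemma letter_step b z z' : letter b z = letter b.+1 z' ->
  (z = z' /\ forall a, a < m -> C a b.+1 = (C a b).+1 ->
     z < 6 * a + 3 \/ 6 * a + 6 < z) \/
  exists a, [/\ a < m, C a b.+1 = (C a b).+1 & turned a z z'].
Proof.
case/letter_eq=> [[<- mz]|[a [r [r' [[am r4 r4' -> ->] E]]]]].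
  left; split=> // a am _; case: (ltnP z (6 * a + 3)) => h1; first by left.
  case: (ltnP (6 * a + 6) z) => h2; first by right.
  case/mobileP: mz; exists a, (z - (6 * a + 3)); split; lia.
case: (C_step a b) => Cab; rewrite Cab in E.
  move/eqP: E; rewrite eqn_modDr !modn_small ?flip_lt // => /eqP/flip_inj er.
  left; split=> [|a' am' Ca']; first by rewrite er.
  case: (eqVneq a a') => [ea|]; last by lia.
  by rewrite -ea Cab in Ca'; lia.
right; exists a; split=> //; move: E; rewrite addnS -addSn => /eqP; rewrite eqn_modDr => /eqP.
by move: r r4 r' r4' => [|[|[|[|]]]] // _ [|[|[|[|]]]] //= _ _;
  [apply: Turned35|apply: Turned43|apply: Turned56|apply: Turned64]; lia.
Qed.

(** Thus [l] is the number of even cells, and in each row one of the [l.+1] conveyor slots is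
    waiting. *)
Hypothesis Nl : N <= 2 * l <= N + 1.
Hypothesis l_ge : 22 <= l.
Hypothesis m_le : 6 * m + 2 <= N.

(** * Letters that recur within twelve rows *)

Definition to_end g := l.+1 - g %% l.+1.
Definition active g a := C a (g %/ l.+1).+1 = (C a (g %/ l.+1)).+1.

Definition quiet g z := forall a, a < m -> active g a -> z < 6 * a + 3 \/ 6 * a + 6 < z.

(* The cells [c] and [c'] that a letter moved by the 4-cycle of site [a] occupies
   [u] rows before and [v] rows after the start of a block; the second options
   account for the reduction of conveyor indices modulo [l.+1]. *)
Variant moved a u v c c' : Prop :=
| Moved35 of c = 6 * a + 3 & c' = 6 * a + 5
| Moved43 x of c = 2 * x & c' = 6 * a + 3 &
    x + u = 3 * a + 2 \/ x + u = 3 * a + 2 + l.+1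
| Moved56 x' of c = 6 * a + 5 & c' = 2 * x' &
    x' = 3 * a + 3 + v \/ x' + l.+1 = 3 * a + 3 + v
| Moved64 x x' of c = 2 * x & c' = 2 * x' &
    x + u = 3 * a + 3 \/ x + u = 3 * a + 3 + l.+1 &
    x' = 3 * a + 2 + v \/ x' + l.+1 = 3 * a + 2 + v.

(** In [NearConveyor], [w] is the conveyor index of the slot seen in cell [c]; if a block starts in
    between, no active site may have touched this slot. *)
Variant near_spec g rho c c' : Prop :=
| NearStatic x of c = 2 * x + 1 & c' = c & (to_end g <= rho -> quiet g c)
| NearConveyor x x' w of c = 2 * x & c' = 2 * x' &
    x' = x + rho \/ x' + l.+1 = x + rho &
    w = x + to_end g \/ w + l.+1 = x + to_end g & (to_end g <= rho -> quiet g (2 * w))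
| NearMoved a of to_end g <= rho & a < m & active g a &
    moved a (to_end g) (rho - to_end g) c c'.

Lemma turned_moved a u v c c' : 0 < u <= l.+1 -> v <= l.+1 ->
  turned a (slot (l.+1 - u) c) (slot v c') -> moved a u v c c'.
Proof.
move=> u0 vl T; case: T; case: slotP => x cE; case: slotP => x' cE';
  try by [move=> *; exfalso; lia].
- by move=> ? ?; apply: Moved35; lia.
all: move=> *.
all: first
  [ by apply: (@Moved43 _ _ _ _ _ x); [lia|lia|first [left; lia|right; lia]]
  | by apply: (@Moved56 _ _ _ _ _ x'); [lia|lia|first [left; lia|right; lia]]
  | by apply: (@Moved64 _ _ _ _ _ x x');
      [lia|lia|first [left; lia|right; lia]|first [left; lia|right; lia]]].
Qed.

Lemma to_end_gt0 g : 0 < to_end g <= l.+1.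
Proof. by rewrite /to_end; have := ltn_pmod g (ltn0Sn l); lia. Qed.

(** Twelve rows are fewer than the [l.+1] rows of a block, so at most one block boundary, hence at
    most one turn of each site, lies in between. *)
Lemma near g rho c c' : c < N -> c' < N -> rho <= 12 ->
  cell_letter g c = cell_letter (g + rho) c' -> near_spec g rho c c'.
Proof.
move=> cN cN' rho12; rewrite /cell_letter; have u0 := to_end_gt0 g.
have gE := divn_eq g l.+1; have sE : g %% l.+1 = l.+1 - to_end g.
  by rewrite /to_end subKn // ltnW // ltn_pmod.
rewrite sE in gE *; case: (leqP (to_end g) rho) => h.
  have [-> ->] : (g + rho) %/ l.+1 = (g %/ l.+1).+1 /\
      (g + rho) %% l.+1 = rho - to_end g.
    have -> : g + rho = (g %/ l.+1).+1 * l.+1 + (rho - to_end g).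
      by rewrite {1}gE mulSn; lia.
    have lt_l : rho - to_end g < l.+1 by lia.
    by rewrite divnMDl // modnMDl (divn_small lt_l) (modn_small lt_l) addn0.
  case/letter_step => [[Z Qz]|[a [am act T]]]; last first.
    by apply: (@NearMoved _ _ _ _ a) => //; apply: turned_moved T => //; lia.
  have {}Qz : to_end g <= rho -> quiet g (slot (l.+1 - to_end g) c) by [].
  clear gE sE; move: Z Qz.
  case: slotP => x cE; case: slotP => x' cE'; try by [move=> *; exfalso; lia].
  - by move=> Z Qz; apply: (@NearStatic _ _ _ _ x); rewrite ?cE ?cE' //; lia.
  - move=> h1 h2 Z Qz; apply: (@NearConveyor _ _ _ _ x x' (x - (l.+1 - to_end g))) => //.
      by right; lia.
    by right; lia.
  - move=> h1 h2 Z Qz; apply: (@NearConveyor _ _ _ _ x x' (x + l.+1 - (l.+1 - to_end g))) => //.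
      by left; lia.
    by left; lia.
  - move=> h1 h2 Z Qz; apply: (@NearConveyor _ _ _ _ x x' (x + l.+1 - (l.+1 - to_end g))) => //.
      by right; lia.
    by left; lia.
have [-> ->] : (g + rho) %/ l.+1 = g %/ l.+1 /\
    (g + rho) %% l.+1 = l.+1 - to_end g + rho.
  have -> : g + rho = (g %/ l.+1) * l.+1 + (l.+1 - to_end g + rho) by rewrite {1}gE addnA.
  have lt_l : l.+1 - to_end g + rho < l.+1 by lia.
  by rewrite divnMDl // modnMDl (divn_small lt_l) (modn_small lt_l) addn0.
clear gE sE; move/letter_inj.
have noQ z : to_end g <= rho -> quiet g z by rewrite leqNgt h.
case: slotP => x cE; case: slotP => x' cE'; try by [move=> *; exfalso; lia].
- by move=> Z; apply: (@NearStatic _ _ _ _ x); rewrite ?cE ?cE' //; lia.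
all: move=> h1 h2 Z; apply: (@NearConveyor _ _ _ _ x x' (x + to_end g)) => //;
  [first [left; lia|right; lia]|by left|exact: noQ].
Qed.

Ltac lia_cases := first
  [ exfalso; repeat match goal with H : _ \/ _ |- _ => clear H end; lia
  | repeat match goal with H : _ \/ _ |- _ => destruct H end; lia ].

(** * Repetitions whose period is below twelve rows *)

Lemma wordE g c : c < N -> word (g * N + c) = cell_letter g c.
Proof.
by move=> cN; rewrite /word divnMDl ?modnMDl ?divn_small ?modn_small ?addn0 //; lia.
Qed.

Lemma posP t : exists g c, c < N /\ t = g * N + c.
Proof.
by exists (t %/ N), (t %% N); rewrite -divn_eq ltn_pmod //; lia.
Qed.

Lemma pos_inj g c g' c' : c < N -> c' < N -> g * N + c = g' * N + c' ->
  g = g' /\ c = c'.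
Proof.
move=> cN cN' E; have n0 : 0 < N by lia.
have := congr1 (modn^~ N) E; have := congr1 (divn^~ N) E.
by rewrite !divnMDl // !modnMDl !divn_small // !modn_small // !addn0.
Qed.

(** Letters within a row are distinct, and a letter that recurs in the next row keeps its column or
    moves to the right, even when a site turns. *)
Lemma no_rep1 t p : 0 < p < N -> word t <> word (t + p).
Proof.
move=> p0N; have [g [c [cN ->]]] := posP t; have u0 := to_end_gt0 g.
case: (ltnP (c + p) N) => h.
  rewrite -addnA !wordE // -{2}[g]addn0 => E.
  by case: (near cN h (isT : 0 <= 12) E) => *; lia_cases.
have -> : g * N + c + p = (g + 1) * N + (c + p - N) by lia.
have cN' : c + p - N < N by lia.
rewrite !wordE // => E.
by case: (near cN cN' (isT : 1 <= 12) E) => [*|*|a u1 am _]; try lia_cases; case=> *; lia_cases.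
Qed.

(** These are the untouched static cells near the two ends of a row; three successive positions
    across a row break always meet one. *)
Definition fixed_cell c := odd c && ((c == 1) || (6 * m < c)).

Lemma fixed_cell_eq g rho c c' : c < N -> c' < N -> rho <= 12 ->
  cell_letter g c = cell_letter (g + rho) c' ->
  fixed_cell c || fixed_cell c' -> c' = c.
Proof.
move=> cN cN' r12 E F.
case: (near cN cN' r12 E) => [*|x x' w cE cE' _ _ _|a ur am _ M] //.
  by move: F; rewrite /fixed_cell cE cE' !oddM.
by case: M => *; move: F; rewrite /fixed_cell => /orP[] /andP[o /orP[/eqP|]]; lia_cases.
Qed.

(** The conveyor alone needs [l.+1] rows to bring a letter back; only the move from slot [6 * a + 6]
    to [6 * a + 4] can cancel a step. *)
Lemma even_cell_eq g rho c : c < N -> ~~ odd c -> 0 < rho <= 12 ->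
  cell_letter g c = cell_letter (g + rho) c ->
  rho = 1 /\ exists a, c = 6 * a + 4.
Proof.
move=> cN oc r12 E; have u0 := to_end_gt0 g; have r12' : rho <= 12 by lia.
case: (near cN cN r12' E) => [x cE|*|a ur am _]; try lia_cases.
case=> [*|*|*|x x' cE cE' h1 h2]; try lia_cases.
suff [-> ->] : rho = 1 /\ c = 6 * a + 4 by split=> //; exists a.
by clear r12' E oc; split; lia_cases.
Qed.

(** The condition on [rho] expresses [N <= p < 2 * N]. One of two neighbours is static and the other
    on the conveyor, so they shift differently, and site moves do not repair this. *)
Lemma no_rep2_inrow g rho c c' : c + 1 < N -> c' + 1 < N ->
  rho = 1 /\ c <= c' \/ rho = 2 /\ c' < c ->
  cell_letter g c = cell_letter (g + rho) c' ->
  cell_letter g (c + 1) = cell_letter (g + rho) (c' + 1) -> False.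
Proof.
move=> h2 h2' pN E1 E2; have u0 := to_end_gt0 g.
have [h1 h1'] : c < N /\ c' < N by split; lia.
have r12 : rho <= 12 by lia_cases.
have N1 := near h1 h1' r12 E1; have N2 := near h2 h2' r12 E2; clear E1 E2 r12.
case: N1 => [x cE cE' Q1|x x' w cE cE' xx wE Q1|a ur am act T];
case: N2 => [x2 cE2 cE2' Q2|x2 x2' w2 cE2 cE2' xx2 wE2 Q2|a' ur' am' act' T'];
  try lia_cases.
- by have {}Q1 := Q1 ur' a' am' act'; case: T' => *; lia_cases.
- by have {}Q1 := Q1 ur' a' am' act'; case: T' => *; lia_cases.
- by have {}Q2 := Q2 ur a am act; case: T => *; lia_cases.
- by have {}Q2 := Q2 ur a am act; case: T => *; lia_cases.
- by case: T => *; try lia_cases; case: T' => *; lia_cases.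
Qed.

Lemma no_rep2 t p : N <= p < 2 * N -> word t = word (t + p) ->
  word t.+1 = word (t + p).+1 -> False.
Proof.
have [g [c [cN ->]]] := posP t => pN.
have [rho [c' [cN' [Ep Hp]]]] : exists rho c', c' < N /\
    (g * N + c + p = (g + rho) * N + c' /\ (rho = 1 /\ c <= c' \/ rho = 2 /\ c' < c)).
  case: (ltnP (c + p) (2 * N)) => h; [exists 1, (c + p - N)|exists 2, (c + p - 2 * N)]; lia.
rewrite Ep wordE // wordE // => E1.
have r12 : rho <= 12 by lia.
have n0 : 0 < N by lia.
have next g0 c0 : c0 < N -> (g0 * N + c0).+1 =
    (if c0 + 1 < N then g0 else g0.+1) * N + (if c0 + 1 < N then c0 + 1 else 0).
  by move=> ?; case: ifP => ?; lia.
have u0 := to_end_gt0 g; have uS0 := to_end_gt0 g.+1.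
rewrite !next //.
case: (ltnP (c + 1) N) => hc; case: (ltnP (c' + 1) N) => hc'; rewrite !wordE // => E2.
- exact: no_rep2_inrow E1 E2.
- rewrite -addnS in E2; have r12' : rho.+1 <= 12 by lia_cases.
  have N1 := near cN cN' r12 E1; have N2 := near hc n0 r12' E2.
  clear E1 E2 r12 r12' Ep next.
  by case: N1 => [*|*|a ur am act T]; case: N2 => [*|*|a' ur' am' act' T'];
    try lia_cases; try (case: T => *; try lia_cases);
    try (case: T' => *; lia_cases).
- have er : rho = 2 by lia_cases.
  rewrite (_ : g + rho = g.+1 + 1) in E2; last lia.
  have N1 := near cN cN' r12 E1; have N2 := near n0 hc' (isT : 1 <= 12) E2.
  clear E1 E2 r12 Ep next.
  by case: N1 => [*|*|a ur am act T]; case: N2 => [*|*|a' ur' am' act' T'];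
    try lia_cases; try (case: T => *; try lia_cases);
    try (case: T' => *; lia_cases).
- have er : rho = 1 by lia_cases.
  rewrite (_ : (g + rho).+1 = g.+1 + 1) in E2; last lia.
  by case: (even_cell_eq n0 isT _ E2) => // _ [a]; lia.
Qed.

Lemma no_rep_rows t rho : 2 <= rho <= 12 -> word t = word (t + rho * N) ->
  word t.+1 = word (t + rho * N).+1 -> False.
Proof.
move=> r12; have key g c : c < N -> ~~ odd c ->
    word (g * N + c) = word (g * N + c + rho * N) -> False.
  move=> cN oc; have -> : g * N + c + rho * N = (g + rho) * N + c by lia.
  by rewrite !wordE // => /even_cell_eq; case=> //; lia.
have [g [c [cN ->]]] := posP t; case: (boolP (odd c)) => oc E1 E2; last exact: key E1.
have {}E2 : word (g * N + c.+1) = word (g * N + c.+1 + rho * N) by rewrite addnS addSn.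
case: (ltnP c.+1 N) => hc; first by apply: (key g c.+1) => //; lia.
apply: (key g.+1 0); rewrite ?addn0 //; first lia.
by move: E2; have -> : g * N + c.+1 = g.+1 * N by lia.
Qed.

(** As the columns differ, every match that involves an odd cell must be a site move. *)
Lemma no_rep3_inrow g rho c c' : c + 2 < N -> c' + 2 < N -> 2 <= rho <= 12 -> c' <> c ->
  cell_letter g c = cell_letter (g + rho) c' ->
  cell_letter g (c + 1) = cell_letter (g + rho) (c' + 1) ->
  cell_letter g (c + 2) = cell_letter (g + rho) (c' + 2) -> False.
Proof.
move=> cN cN' r12 cc' E1 E2 E3; have u0 := to_end_gt0 g.
have key i : i <= 2 -> cell_letter g (c + i) = cell_letter (g + rho) (c' + i) ->
    (exists x x', [/\ c + i = 2 * x, c' + i = 2 * x' &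
      x' = x + rho \/ x' + l.+1 = x + rho]) \/
    exists2 a, a < m & moved a (to_end g) (rho - to_end g) (c + i) (c' + i).
  move=> i2 E; have [h1 h2 h3] : [/\ c + i < N, c' + i < N & rho <= 12] by split; lia.
  case: (near h1 h2 h3 E) => [x cE cE' _|x x' w cE cE' xx _ _|a ur am _ M]; first lia.
    by left; exists x, x'.
  by right; exists a.
have := key 0 isT; rewrite !addn0 => /(_ E1) N1.
move: (key 1 isT E2) (key 2 isT E3) => N2 N3; clear E1 E2 E3 key.
case: N2 => [[x [x' [cE cE' xx]]]|[a am T]].
  case: N1 => [[x1 [x1' [cE1 cE1' xx1]]]|[a1 am1 T1]]; first lia_cases.
  case: N3 => [[x3 [x3' [cE3 cE3' xx3]]]|[a3 am3 T3]]; first lia_cases.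
  by case: T1 => *; try lia_cases; case: T3 => *; lia_cases.
by case: T => *; case: N1 => [[x1 [x1' [cE1 cE1' xx1]]]|[a1 am1 T1]]; try lia_cases;
  case: N3 => [[x3 [x3' [cE3 cE3' xx3]]]|[a3 am3 T3]]; try lia_cases;
  case: T1 => *; try lia_cases; case: T3 => *; lia_cases.
Qed.

Lemma no_rep3 t p : 2 * N <= p < 12 * N -> word t = word (t + p) ->
  word t.+1 = word (t + p).+1 -> word t.+2 = word (t + p).+2 -> False.
Proof.
move=> pN E1 E2 E3.
have rowsF rho : p <> rho * N.
  move=> pE; have r12 : 2 <= rho <= 12 by nia.
  by rewrite pE in E1 E2; exact: (@no_rep_rows t rho).
have match_at i g c : i <= 2 -> c < N -> t + i = g * N + c ->
    exists rho c', [/\ c' < N, rho <= 12, t + i + p = (g + rho) * N + c', c' <> c &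
      cell_letter g c = cell_letter (g + rho) c'].
  move=> i2 cN ti.
  have [g' [c' [cN' tp]]] := posP (t + i + p).
  have [rho er] : exists rho, g' = g + rho by exists (g' - g); nia.
  rewrite er in tp; exists rho, c'; split=> //; first nia.
    by move=> e; apply: (rowsF rho); nia.
  rewrite -!wordE // -ti -tp.
  by move: i i2 {ti tp} => [|[|[|]]] // _; rewrite ?addn0 ?addn1 ?addn2 ?addSn.
have straddle i g c : i <= 2 -> c < N -> t + i = g * N + c -> fixed_cell c -> False.
  move=> i2 cN ti F; have [rho [c' [cN' r12 _ cc E]]] := match_at i g c i2 cN ti.
  by apply: cc; apply: fixed_cell_eq E _ => //; rewrite F.
have straddle' i g c : i <= 2 -> c < N -> t + i + p = g * N + c -> fixed_cell c -> False.
  move=> i2 cN ti F; have [g0 [c0 [cN0 t0]]] := posP (t + i).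
  have [rho [c' [cN' r12 e cc E]]] := match_at i g0 c0 i2 cN0 t0.
  have ec : c' = c by case: (@pos_inj (g0 + rho) c' g c); lia.
  by apply: cc; apply: fixed_cell_eq E _ => //; rewrite ec F orbT.
(* The fixed cell is the first or second position if its column is odd, and otherwise cell [1] of
   the next row. *)
have edge g c P : c < N -> N <= c + 2 ->
    (forall i h d, i <= 2 -> d < N -> g * N + c + i = h * N + d -> fixed_cell d -> P) -> P.
  move=> cN cN2 H; case: (boolP (odd c)) => oc.
    by apply: (H 0 g c) => //; rewrite /fixed_cell; lia.
  case: (ltnP c.+1 N) => h1.
    by apply: (H 1 g c.+1) => //; rewrite /fixed_cell; lia.
  by apply: (H 2 g.+1 1) => //; rewrite /fixed_cell; lia.
have [g [c [cN tE]]] := posP t.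
case: (ltnP (c + 2) N) => hc; last first.
  by apply: (edge g c _ cN hc) => i h d i2 dN e; apply: (straddle i h d) => //; lia.
have [rho [c' [cN' r12 tp cc F1]]] := match_at 0 g c isT cN (etrans (addn0 t) tE).
case: (ltnP (c' + 2) N) => hc'; last first.
  by apply: (edge (g + rho) c' _ cN' hc') => i h d i2 dN e; apply: (straddle' i h d) => //; lia.
apply: (@no_rep3_inrow g rho c c') => //; first by nia.
  rewrite -!wordE; try lia; rewrite (_ : g * N + (c + 1) = t.+1); last lia.
  by rewrite (_ : (g + rho) * N + (c' + 1) = (t + p).+1); last lia.
rewrite -!wordE; try lia; rewrite (_ : g * N + (c + 2) = t.+2); last lia.
by rewrite (_ : (g + rho) * N + (c' + 2) = (t + p).+2); last lia.
Qed.

(** * Longer repetitions have a whole number of blocks as period *)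

Definition repeats t p k := forall x, t <= x < t + k -> word x = word (x + p).

Lemma letter_fixed_eq b z b' z' : letter b z = letter b' z' -> ~~ mobile z -> z' = z.
Proof.
by case/letter_eq=> [[->]//|[a [r [r' [[am r4 _ -> _] _]]]]] /mobileP[]; exists a, r.
Qed.

Lemma slot_odd s c c' : odd c' -> slot s c = c' -> c = c'.
Proof.
by case: slotP => [x ->//|x _ _|x _ _] oc' cE; move: oc'; rewrite -cE oddM.
Qed.

(** Seven successive positions meet a cell [6 * j + 1], which no site touches and whose letter
    occurs in that column only. *)
Lemma long_rep_rows t p k : 7 <= k -> repeats t p k -> exists rho, p = rho * N.
Proof.
move=> k7 rep; have [g [c [cN tE]]] := posP t.
have [g1 [c1 [c1N oc h1 Fc]]] : exists g1 c1, [/\ c1 < N, odd c1,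
    t <= g1 * N + c1 < t + k & ~~ mobile c1].
  case: (ltnP (c + 5) N) => h; last by exists g.+1, 1; rewrite /mobile; split; lia.
  have cE := divn_eq c 6; have r6 := ltn_pmod c (isT : 0 < 6).
  case: (leqP (c %% 6) 1) => r1.
    by exists g, (6 * (c %/ 6) + 1); rewrite /mobile; split; lia.
  by exists g, (6 * (c %/ 6) + 7); rewrite /mobile; split; lia.
have E := rep _ h1; have [g' [c' [cN' E']]] := posP (g1 * N + c1 + p).
move: E; rewrite E' !wordE // /cell_letter [slot _ c1]/slot oc.
move/letter_fixed_eq=> /(_ Fc) /(slot_odd oc) ec.
by exists (g' - g1); rewrite mulnBl; clear -ec E'; lia.
Qed.

Lemma slot_inj s s' c : s <= l -> s' <= l -> c < N -> ~~ odd c ->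
  slot s c = slot s' c -> s = s'.
Proof.
move=> sl sl' cN oc; case: slotP => x cE; case: slotP => x' cE'; lia.
Qed.

Lemma mobile_even x : mobile (2 * x) -> exists2 a, a < m & x = 3 * a + 2 \/ x = 3 * a + 3.
Proof.
by case/mobileP=> a [[|[|[|[|r]]]] [xE am r4]]; exists a => //; first [left; lia|right; lia|lia].
Qed.

(** Sites occupy at most two of any three cyclically successive conveyor slots. *)
Lemma some_fixed_slot s c : s <= l -> ~~ odd c -> c + 4 < N ->
  exists2 i, i <= 2 & ~~ mobile (slot s (c + 2 * i)).
Proof.
move=> sl oc cN.
have [x cE] : exists x, c = 2 * x by exists c./2; have := odd_double_half c; lia.
have slotE i : slot s (c + 2 * i) =
    2 * (if s <= x + i then x + i - s else x + i + l.+1 - s).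
  by case: slotP => y yE *; case: (leqP s (x + i)) => *; lia.
case: (boolP (mobile (slot s (c + 2 * 0)))) => h0; last by exists 0.
case: (boolP (mobile (slot s (c + 2 * 1)))) => h1; last by exists 1.
case: (boolP (mobile (slot s (c + 2 * 2)))) => h2; last by exists 2.
move: h0 h1 h2; rewrite !slotE => /mobile_even[a am A] /mobile_even[b bm B].
case/mobile_even=> d dm D; clear slotE oc.
by move: A B D; do 3!case: leqP => ?; move=> *; lia_cases.
Qed.

(** Twelve positions contain three successive even cells of one row, hence an immobile conveyor
    slot, which visits a given cell only once in [l.+1] rows. *)
Lemma long_rep_blocks t p k : 12 <= k -> repeats t p k ->
  exists q, p = q * (l.+1 * N).
Proof.
move=> k12 rep; have [rho pE] : exists rho, p = rho * N.
  by apply: (@long_rep_rows t p k) => //; lia.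
have [g [c [cN tE]]] := posP t.
have [g1 [c1 [oc c1N h1]]] : exists g1 c1, [/\ ~~ odd c1, c1 + 4 < N &
    t <= g1 * N + c1 /\ g1 * N + c1 + 4 < t + k].
  case: (ltnP (c + 5) N) => h; last by exists g.+1, 0; split; lia.
  by exists g, (c + odd c); split; lia.
have sl : g1 %% l.+1 <= l by rewrite -ltnS ltn_pmod.
have [i i2 Fz] := some_fixed_slot sl oc c1N.
have ciN : c1 + 2 * i < N by lia.
have := rep (g1 * N + (c1 + 2 * i)); rewrite pE.
have -> : g1 * N + (c1 + 2 * i) + rho * N = (g1 + rho) * N + (c1 + 2 * i) by lia.
rewrite !wordE // => E; move/letter_fixed_eq: (E ltac:(lia)) => /(_ Fz) S.
have sl' : (g1 + rho) %% l.+1 <= l by rewrite -ltnS ltn_pmod.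
have oci : ~~ odd (c1 + 2 * i) by rewrite oddD oddM addbF.
have es := slot_inj sl' sl ciN oci S.
have : l.+1 %| rho.
  by move/eqP: es; rewrite -{2}[g1]addn0 eqn_modDl mod0n.
by case/dvdnP=> q ->; exists q; rewrite mulnA.
Qed.

(** Static cells show the state of their site in every row of a block. *)
Lemma rep_site t k q g a c : repeats t (q * (l.+1 * N)) k -> a < m ->
  c = 6 * a + 3 \/ c = 6 * a + 5 -> t <= g * N + c < t + k ->
  C a (g %/ l.+1) = C a (g %/ l.+1 + q) %[mod 4].
Proof.
move=> rep am Hc hg; have cN : c < N by lia.
have := rep _ hg.
have -> : g * N + c + q * (l.+1 * N) = (q * l.+1 + g) * N + c by lia.
rewrite !wordE // /cell_letter divnMDl // modnMDl.
have -> : slot (g %% l.+1) c = c by case: Hc => cE; case: slotP => x *; lia.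
rewrite (addnC q).
case: Hc => ->; first by rewrite -(addn0 (6 * a + 3)); exact: letter_static.
by rewrite (_ : 6 * a + 5 = 6 * a + 3 + 2); [exact: letter_static|lia].
Qed.

Lemma window_cell t k c : N <= k -> c < N -> exists g, t <= g * N + c < t + k.
Proof.
move=> kN cN; have [g [d [dN ->]]] := posP t.
case: (leqP d c) => h; [exists g|exists g.+1]; lia.
Qed.

(** The bound [p < k * N] says that the exponent [(p + k) / p] exceeds [(N + 1) / N]. It forces [k]
    above 1, 2 and 12 once [p] reaches [N], [2 * N] and [12 * N], as the preceding exclusions
    require. *)
Lemma rep_blocks t p k : 0 < p -> p < k * N -> repeats t p k ->
  exists q, 0 < q /\ p = q * (l.+1 * N) /\ q * l.+1 < k.
Proof.
move=> p0 pk rep; have n0 : 0 < N by lia.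
have rep0 : word t = word (t + p) by apply: rep; case: k pk => //; lia.
have rep1 : 1 < k -> word t.+1 = word (t + p).+1.
  by move=> k1; rewrite -addSn; apply: rep; lia.
have rep2 : 2 < k -> word t.+2 = word (t + p).+2.
  by move=> k1; rewrite -!addSn; apply: rep; lia.
case: (ltnP p N) => h1; first by case: (@no_rep1 t p) => //; rewrite p0.
case: (ltnP p (2 * N)) => h2.
  have k1 : 1 < k by nia.
  by case: (@no_rep2 t p) => //; [rewrite h1|exact: rep1].
case: (ltnP p (12 * N)) => h3.
  have k1 : 2 < k by nia.
  case: (@no_rep3 t p) => //; [by rewrite h2|by apply: rep1; lia|exact: rep2].
have [q pE] : exists q, p = q * (l.+1 * N).
  by apply: (@long_rep_blocks t p k) => //; nia.
exists q; split; first by case: q pE p0 => // ->.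
by split=> //; move: pk; rewrite pE mulnA ltn_pmul2r.
Qed.

Lemma letter_congr b b' z : (forall a, a < m -> C a b = C a b' %[mod 4]) ->
  letter b z = letter b' z.
Proof.
move=> E; case: (boolP (mobile z)) => [/mobileP[a [r [-> am r4]]]|fz].
  by rewrite !letter_site // -modnDmr E // modnDmr.
by rewrite !letter_fixed.
Qed.

Lemma word_periodic B t :
  (forall a b, a < m -> C a (b + B) = C a b %[mod 4]) ->
  word (t + B * (l.+1 * N)) = word t.
Proof.
move=> CB; have [g [c [cN ->]]] := posP t.
have -> : g * N + c + B * (l.+1 * N) = (B * l.+1 + g) * N + c by lia.
rewrite !wordE // /cell_letter divnMDl // modnMDl addnC.
by apply: letter_congr => a am; rewrite CB.
Qed.

Lemma word_range t : word t < N \/ word t = 2 * l.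
Proof.
have [g [c [cN ->]]] := posP t; rewrite wordE // /cell_letter.
case: (boolP (mobile (slot (g %% l.+1) c))) => [/mobileP[a [r [-> am r4]]]|fz].
  rewrite letter_site //; left; have := flip_lt (ltn_pmod (flip r + C a (g %/ l.+1)) (isT : 0 < 4)).
  by lia.
rewrite letter_fixed //; have := ltn_pmod g (ltn0Sn l).
case: slotP => x cE; try (by left; lia).
move=> xs gl; case: (ltnP (2 * (x + l.+1 - g %% l.+1)) N) => h; [by left|right; lia].
Qed.
End Carousel.

(** * The schedule of turns excludes the remaining repetitions *)

Section Schedule.
Variables (N l m : nat) (y : nat -> bool).
Hypothesis Nl : N <= 2 * l <= N + 1.
Hypothesis l_ge : 22 <= l.
Hypothesis m_le : 6 * m + 2 <= N.
Hypothesis N_lt : N < 6 * m + 8.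
Hypothesis N_ge : 44 <= N.

Let anchor := l.+1 %/ 6.

(* Sites [0] and [anchor] turn at every block and are so placed that every [l + 2]
   consecutive cells meet one of them. The last site turns exactly once in each pair
   of blocks [2i+1, 2i+2], the bit [y i] deciding where. *)
Definition level a := if a == anchor then 0 else if a < anchor then a else a.-1.

Definition schedule a b :=
  if a == m.-1 then b./2 + (odd b && y b./2) else b %/ 4 ^ level a.

(** Half of [4 ^ (m - 2)]: the last site shows one bit per two blocks, so a period of [q] blocks
    shifts [y] by [q / 2]. *)
Let Q := 2 * 4 ^ (m - 3).

Lemma anchor_bounds : 0 < anchor < m.-1 /\ l <= 6 * anchor + 4 /\ 6 * anchor <= l.+1.
Proof. by rewrite /anchor; lia. Qed.

Lemma schedule_step a b :
  schedule a b.+1 = schedule a b \/ schedule a b.+1 = (schedule a b).+1.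
Proof.
rewrite /schedule; case: ifP => _; last first.
  by rewrite divnS ?expn_gt0 //; case: (_ %| _); [right|left].
have -> : b.+1./2 = b./2 + odd b by lia.
rewrite [odd b.+1]/=; case: (odd b) => /=; last by rewrite addn0; case: (y _); lia.
by case: (y b./2); lia.
Qed.

Lemma schedule_anchor a b : a = 0 \/ a = anchor -> schedule a b = b.
Proof.
have [/andP[a0 am] _] := anchor_bounds; rewrite /schedule /level.
case=> ->; case: eqP => [|_]; try lia; last by rewrite eqxx divn1.
by rewrite a0; case: ifP; rewrite divn1.
Qed.

Lemma schedule_level i : i < m - 2 ->
  exists2 a, a < m & forall b, schedule a b = b %/ 4 ^ i.
Proof.
have [/andP[a0 am] _] := anchor_bounds => im.
case: (posnP i) => [->|i0].
  by exists 0 => [|b]; [lia|rewrite schedule_anchor ?divn1 //; left].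
suff [a am' [n1 n2]] : exists2 a, a < m & a <> m.-1 /\ level a = i.
  by exists a => // b; rewrite /schedule n2; case: eqP.
case: (ltnP i anchor) => h.
  by exists i; rewrite ?/level ?h; [lia|split; [lia|case: eqP => //; lia]].
exists i.+1; first lia.
by split; [lia|rewrite /level; case: eqP; [lia|case: ifP => //; lia]].
Qed.

Lemma schedule_noise i : schedule m.-1 (2 * i + 1) = i + y i.
Proof.
rewrite /schedule eqxx; have -> : (2 * i + 1)./2 = i by lia.
by have -> : odd (2 * i + 1) by lia.
Qed.

(** From [44 <= N] follows [7 <= m], and the induction starts with [490 <= 512]; for [m = 6] one
    would have [Q = 128]. *)
Lemma Q_ge : 10 * N <= Q.
Proof.
have m7 : 7 <= m by lia.
suff : 10 * (6 * m + 7) <= Q by lia.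
rewrite /Q; move: (m) m7; elim=> // k IH; rewrite leq_eqVlt => /orP[/eqP <-//|k7].
have := IH k7; have -> : k.+1 - 3 = (k - 3).+1 by lia.
by rewrite expnS; move: (4 ^ _) => X; lia.
Qed.

Lemma dvdn4_Q : 4 %| Q.
Proof.
have -> : Q = 4 * (2 * 4 ^ (m - 4)); last exact: dvdn_mulr.
by rewrite /Q mulnCA -expnS; congr (2 * 4 ^ _); lia.
Qed.

Lemma rep_anchor t q k : repeats N l m schedule t (q * (l.+1 * N)) k -> l.+1 < k -> 4 %| q.
Proof.
move=> rep lk; have [/andP[a0 am] [al1 al2]] := anchor_bounds.
have [g [c [cN tE]]] := posP Nl l_ge m_le t.
have [h [a [d [am' aP dP hP]]]] : exists h a d, [/\ a < m, a = 0 \/ a = anchor,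
    d = 6 * a + 3 \/ d = 6 * a + 5 & t <= h * N + d < t + k].
  have [c1|c1] := leqP c 3; first by exists g, 0, 3; split; lia.
  have [c2|c2] := leqP c 5; first by exists g, 0, 5; split; lia.
  have [c3|c3] := leqP c (6 * anchor + 3).
    by exists g, anchor, (6 * anchor + 3); split; lia.
  have [c4|c4] := leqP c (6 * anchor + 5).
    by exists g, anchor, (6 * anchor + 5); split; lia.
  by exists g.+1, 0, 3; split; lia.
have := rep_site Nl l_ge m_le rep am' dP hP; rewrite !schedule_anchor // => /eqP.
by rewrite -{1}[_ %/ _]addn0 eqn_modDl mod0n eq_sym.
Qed.

(** Divisibility by 4 makes the window at least a row long, so it sees every site. If [4 ^ i]
    divides [q], the site of level [i] turns [q / 4 ^ i] times, again a multiple of 4. *)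
Lemma rep_levels t q k : repeats N l m schedule t (q * (l.+1 * N)) k ->
  0 < q -> q * l.+1 < k -> 2 * Q %| q.
Proof.
move=> rep q0 qk; have q4 : 4 %| q by apply: rep_anchor rep _; nia.
have kN : N <= k by have := dvdn_leq q0 q4; nia.
suff : forall i, i <= m - 2 -> 4 ^ i %| q.
  by move/(_ _ (leqnn _)); rewrite /Q mulnA -expnS; have -> : (m - 3).+1 = m - 2 by lia.
elim=> [|i IH] im; first by rewrite dvd1n.
have /dvdnP[e qE] := IH (ltnW im).
have [a am aP] := schedule_level im.
have cN : 6 * a + 3 < N by lia.
have [g gP] := window_cell Nl l_ge m_le t kN cN.
have := rep_site Nl l_ge m_le rep am (or_introl erefl) gP.
rewrite !aP qE addnC divnMDl ?expn_gt0 // => /eqP.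
rewrite -{1}[_ %/ 4 ^ i]add0n eqn_modDr mod0n eq_sym => e4.
by rewrite expnS dvdn_mul.
Qed.

(** With [q = 2 * e * Q], [Q_ge] makes the window span [20 * e] blocks, which leaves room for
    [9 * e] aligned pairs of blocks, a full arc of [y]. *)
Lemma no_rep t p k H : 0 < p -> p < k * N -> p + k <= 2 * H * (l.+1 * N) ->
  (forall i e, 0 < e -> e * (Q + 9) <= H ->
    exists2 r, r < 9 * e & y (i + r) != y (i + r + e * Q)) ->
  repeats N l m schedule t p k -> False.
Proof.
move=> p0 pk pkH y_noise rep.
have [q [q0 [pE qk]]] := rep_blocks schedule_step Nl l_ge m_le p0 pk rep.
rewrite pE in rep pkH; have /dvdnP[e qE] := rep_levels rep q0 qk.
have e0 : 0 < e by lia.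
have L0 : 0 < l.+1 * N by lia.
have long : 20 * e * (l.+1 * N) <= q * l.+1.
  have -> : q * l.+1 = 2 * e * l.+1 * Q by rewrite qE; lia.
  have -> : 20 * e * (l.+1 * N) = 2 * e * l.+1 * (10 * N) by lia.
  by rewrite leq_mul2l Q_ge orbT.
have eH : e * (Q + 9) <= H.
  have : (2 * (e * (Q + 10))) * (l.+1 * N) <= 2 * H * (l.+1 * N).
    apply: leq_trans pkH; apply: leq_trans (leq_add (leqnn _) (ltnW qk)).
    apply: leq_trans (leq_add (leqnn _) long).
    by rewrite qE -mulnDl; apply: leq_mul => //; lia.
  by rewrite leq_pmul2r //; lia.
have [L LE] : exists L, L = l.+1 * N by exists (l.+1 * N).
rewrite -LE in rep pkH long L0.
(* The arc starts with the first pair of blocks that begins after [t]. *)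
have [r re] := y_noise (t %/ (2 * L)).+1 e e0 eH; case/eqP.
have tl : t %% (2 * L) < 2 * L by rewrite ltn_pmod //; lia.
move: (t %/ (2 * L)) (divn_eq t (2 * L)) => i0 tE.
set i := i0.+1 + r.
have site : m.-1 < m by lia.
have w : t <= ((2 * i + 1) * l.+1) * N + (6 * m.-1 + 3) < t + k.
  have -> : (2 * i + 1) * l.+1 * N = (2 * i + 1) * L by lia.
  have h1 : (2 * i0 + 2) * L <= (2 * i + 1) * L by rewrite leq_mul2r /i; lia.
  have h2 : (2 * i + 2) * L <= (2 * i0 + 18 * e + 2) * L by rewrite leq_mul2r /i; lia.
  have h3 : L <= e * L by rewrite leq_pmull.
  have h4 : 6 * m.-1 + 3 < L by rewrite LE; lia.
  by lia.
have := @rep_site N l m schedule Nl l_ge m_le t k q _ m.-1 _ _ site (or_introl erefl) w.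
rewrite -LE => /(_ rep); rewrite mulnK //.
have -> : 2 * i + 1 + q = 2 * (i + e * Q) + 1 by rewrite qE; lia.
rewrite !schedule_noise -addnA => /eqP; rewrite eqn_modDl.
(* Since 4 divides [Q], the turn counts modulo 4 differ only by the two bits. *)
have /dvdnP[Q4 ->] := dvdn4_Q; rewrite mulnA modnMDl.
by case: (y i); case: (y _).
Qed.

(** [2 * H] is a multiple of [4 ^ (m - 2)] while levels are at most [m - 3]; the last site gains [H]
    turns, a multiple of 4. *)
Lemma schedule_periodic H a b : Q %| H -> (forall i, y (i + H) = y i) -> a < m ->
  schedule a (b + 2 * H) = schedule a b %[mod 4].
Proof.
move=> QH yH am; have [/andP[a0 aN] _] := anchor_bounds.
have /dvdnP[h hE] := dvdn_trans dvdn4_Q QH.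
rewrite /schedule; case: eqP => am1.
  have -> : (b + 2 * H)./2 = b./2 + H by lia.
  have -> : odd (b + 2 * H) = odd b by lia.
  by rewrite yH addnAC hE addnC modnMDl.
have lm : level a <= m - 3 by rewrite /level; case: eqP => //; case: ifP; lia.
case/dvdnP: QH => Z ->.
have -> : b + 2 * (Z * Q) = (4 * (Z * 4 ^ (m - 3 - level a))) * 4 ^ level a + b.
  by rewrite -!mulnA -expnD subnK // /Q; move: (4 ^ _) => X; lia.
by rewrite divnMDl ?expn_gt0 // mulnC modnMDl.
Qed.
End Schedule.

(** * Repetition thresholds *)

From mathcomp Require Import all_classical all_reals.

Section Thresholds.
Local Open Scope ring_scope.
Variables (R : realType) (n : nat).

Lemma conjugate_refl (T : eqType) (w : seq T) : conjugate w w.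
Proof. by exists [::], w; rewrite cats0. Qed.

Lemma circular_free_word (T : eqType) (r : R) (w : seq T) :
  circular_free r (circular_word w) -> word_free r w.
Proof. by move=> cf u uw; apply: cf; exists w => //; exact: conjugate_refl. Qed.

Lemma infE (S : set R) (x : R) : (forall r, S r -> x <= r) -> (forall r, x < r -> S r) ->
  inf S = x.
Proof.
move=> xS Sx; apply/eqP; rewrite eq_le; apply/andP; split.
  apply/ler_addgt0Pr => e e0; apply: ge_inf; first by exists x => r /xS.
  by apply: Sx; rewrite ltrDl.
by apply: lb_le_inf; [exists (x + 1); apply: Sx; rewrite ltrDl|].
Qed.

Lemma drop_take_infix (T : eqType) (w : seq T) i k : infix (take k (drop i w)) w.
Proof.
by apply/infixP; exists (take i w), (drop k (drop i w)); rewrite !cat_take_drop.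
Qed.

Lemma exponent_ge_period (T : eqType) (u : seq T) p (x : R) : period u p ->
  x * p%:R <= (size u)%:R -> x <= exponent R u.
Proof.
move=> up xp; apply: le_trans (_ : (size u)%:R / p%:R <= _).
  by rewrite ler_pdivlMr // ltr0n; case: up.
by have [_] := exponent_max R u; apply.
Qed.

Lemma onth_nth (T : eqType) (x0 : T) (s : seq T) i : (i < size s)%N -> onth s i = Some (nth x0 s i).
Proof. by elim: s i => //= x s IH [|i] //=; exact: IH. Qed.

Lemma unavoidable (r : R) (w : seq 'I_n) : (1 < n)%N -> r < n%:R / (n%:R - 1) ->
  (2 * n <= size w)%N -> word_free r w -> False.
Proof.
move=> n1 rn wn fw.
have n0 : (0 < n)%N by lia.
pose x0 : 'I_n := Ordinal n0.
have nR : 1 < n%:R :> R by rewrite ltr1n.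
have bad u : infix u w -> n%:R / (n%:R - 1) <= exponent R u -> False.
  by move=> uw ue; apply: (fw u uw); apply: le_trans (ltW rn) ue.
have close i p : (0 < p < n)%N -> (i + p < size w)%N -> nth x0 w i = nth x0 w (i + p) -> False.
  move=> p0 ip wi; pose u := take p.+1 (drop i w).
  have su : size u = p.+1 by rewrite size_take size_drop; case: ifP; lia.
  apply: (bad u); first exact: drop_take_infix.
  apply: (@exponent_ge_period _ _ p).
    split=> [|j]; first lia; rewrite su => jp; have -> : j = 0%N by lia.
    by rewrite !(onth_nth x0) ?su // ; rewrite /u !nth_take // !nth_drop ?add0n ?addn0 wi.
  rewrite su mulrAC ler_pdivrMr; last by lra.
  have -> : p.+1%:R = p%:R + 1 :> R by rewrite -addn1 natrD.
  have : p%:R + 1 <= n%:R :> R by rewrite natr1 ler_nat; lia.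
  nra.
(* Two of [n + 1] successive letters agree by pigeonhole, and [close] leaves only the two ends. *)
have far i : (i + n < size w)%N -> nth x0 w i = nth x0 w (i + n).
  move=> iw; apply/eqP/negPn/negP => nE.
  have : ~~ injectiveb (fun j : 'I_n.+1 => nth x0 w (i + j)).
    apply/negP => /injectiveP inj; have := leq_card _ inj; rewrite !card_ord; lia.
  case/injectivePn => j [k]; wlog jk : j k / (j < k)%N.
    move=> W; case: (ltngtP j k) => [||/val_inj ->]; last by rewrite eqxx.
      exact: W.
    by move=> kj jk jE; apply: (W k j) => //; rewrite eq_sym.
  move=> _ jE; have := ltn_ord k; rewrite ltnS => kn.
  case: (ltnP (k - j) n) => kj.
    by apply: (close (i + j)%N (k - j)%N); rewrite -?addnA ?subnKC //; lia.
  have [j0 kE] : j = 0%N :> nat /\ k = n :> nat by lia.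
  by move: jE nE; rewrite j0 kE addn0 => ->; rewrite eqxx.
pose u := take (2 * n) (drop 0 w).
have su : size u = (2 * n)%N by rewrite /u drop0 size_take; case: ifP; lia.
apply: (bad u); first exact: drop_take_infix.
apply: (@exponent_ge_period _ _ n).
  split=> // j; rewrite su => jn.
  rewrite !(onth_nth x0) ?su //; try lia.
  by rewrite /u !nth_take ?drop0 -?far //; lia.
rewrite su mulrAC ler_pdivrMr; last by lra.
rewrite natrM; have : 2 <= n%:R :> R by rewrite ler_nat.
nra.
Qed.

(** A conjugate of one period of [F] is a window of [F], so circular factors become linear ones. *)
Lemma circular_factor_mkseq (T : eqType) (F : nat -> T) L (u : seq T) :
  (forall t, F (t + L)%N = F t) -> circular_factor (circular_word (mkseq F L)) u ->
  (size u <= L)%N /\ exists t, forall i, (i < size u)%N -> onth u i = Some (F (t + i)%N).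
Proof.
move=> FL [_ [v1 [v2 [wE ->]]] /infixP[p1 [p2 xE]]].
have sL : (size v1 + size v2 = L)%N by rewrite -size_cat -wE size_mkseq.
have su : (size p1 + (size u + size p2) = L)%N.
  by rewrite -!size_cat -xE size_cat addnC.
split; first lia; exists (size v1 + size p1)%N => i iu.
have -> : onth u i = onth (v2 ++ v1) (size p1 + i)%N.
  rewrite xE (onth_nth (F 0%N)) // (onth_nth (F 0%N)) ?size_cat; last lia.
  rewrite nth_cat ltnNge leq_addr /= addKn nth_cat iu.
  by [].
rewrite (onth_nth (F 0%N)) ?size_cat; last lia.
congr Some; rewrite -addnA; have : (size p1 + i < L)%N by lia.
move: (size p1 + i)%N => j jL.
have nthw k : (k < L)%N -> nth (F 0%N) (v1 ++ v2) k = F k by move=> kL; rewrite -wE nth_mkseq.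
rewrite nth_cat; case: ltnP => j2.
  have jv : (size v1 + j < L)%N by lia.
  by rewrite -(nthw _ jv) nth_cat ltnNge leq_addr /= addKn.
have -> : (size v1 + j = j - size v2 + L)%N by lia.
have jv : (j - size v2 < L)%N by lia.
by rewrite FL -(nthw _ jv) nth_cat ifT //; lia.
Qed.
End Thresholds.


Local Open Scope ring_scope.

Lemma circular_words_exist (R : realType) n M : (45 <= n)%N ->
  exists w : seq 'I_n, (M <= size w)%N /\
    forall r : R, n%:R / (n%:R - 1) < r -> circular_free r (circular_word w).
Proof.
move=> n45; pose N := n.-1; pose l := n./2; pose m := ((N - 2) %/ 6)%N.
have Nl : (N <= 2 * l <= N + 1)%N by rewrite /N /l; lia.
have l_ge : (22 <= l)%N by rewrite /l; lia.
have m_le : (6 * m + 2 <= N)%N by rewrite /m /N; lia.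
have N_lt : (N < 6 * m + 8)%N by rewrite /m /N; lia.
have N_ge : (44 <= N)%N by rewrite /N; lia.
(* [Q] divides [H] for [schedule_periodic], and [M.+1] makes the word long enough. *)
pose Q := (2 * 4 ^ (m - 3))%N; pose H := (Q * M.+1)%N.
have Q_big := @Q_ge N l m Nl l_ge m_le N_lt N_ge.
have Q9 : (9 <= Q)%N by rewrite /Q; lia.
have H0 : (0 < H)%N by rewrite muln_gt0; lia.
have [y [yH y_noise]] := exists_noise H0 Q9.
pose W := word N l m (schedule l m y); pose L := (2 * H * (l.+1 * N))%N.
have WL t : W (t + L)%N = W t.
  apply: (word_periodic Nl l_ge m_le) => a b am.
  by apply: (schedule_periodic Nl l_ge m_le) => //; exact: dvdn_mulr.
(* The only value of [W] that is not below [N] is [2 * l], so cutting off at [N] merges no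
   letters. *)
have code_lt t : (minn (W t) N < n)%N by rewrite /N; lia.
pose F t : 'I_n := Ordinal (code_lt t).
have F_inj t t' : F t = F t' -> W t = W t'.
  move=> /(congr1 val) /=.
  have := word_range (schedule l m y) Nl l_ge m_le t.
  have := word_range (schedule l m y) Nl l_ge m_le t'; rewrite -/W; lia.
have FL t : F (t + L)%N = F t by apply/val_inj; rewrite /= WL.
exists (mkseq F L); split; first rewrite size_mkseq /L /H.
  apply: leq_trans (leq_pmulr _ _); last by rewrite muln_gt0 /=; lia.
  rewrite mulnCA mulnA; apply: leq_trans (leqnSn M) (leq_pmull _ _).
  by rewrite muln_gt0 /=; lia.
move=> r nr u uC ru; have [uL [t ut]] := circular_factor_mkseq FL uC.
have [[p [p0 up] eu] _] := exponent_max R u.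
have pu : (n * p < size u * N)%N.
  have nE : n%:R = N%:R + 1 :> R by rewrite /N natr1; congr (_%:R); lia.
  have NR : 0 < N%:R :> R by rewrite ltr0n; lia.
  have pR : 0 < p%:R :> R by rewrite ltr0n.
  have := lt_le_trans nr ru; rewrite eu nE addrK ltr_pdivrMr // mulrAC ltr_pdivlMr //.
  by rewrite -nE -!natrM ltr_nat.
have nS : n = N.+1 by rewrite /N; lia.
have lt_pu : (p < size u)%N.
  rewrite ltnNge; apply: contraL pu => up'; rewrite -leqNgt mulnC leq_mul //.
  by rewrite nS.
apply: (@no_rep N l m y Nl l_ge m_le N_lt N_ge t p (size u - p) H) => //.
- by rewrite mulnBl ltn_subRL addnC -mulnS -nS mulnC.
- by rewrite subnKC // ltnW.
- move=> x xP; apply: F_inj.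
  have ex : x = (t + (x - t))%N by lia.
  have iu : (x - t + p < size u)%N by lia.
  have := up _ iu; rewrite !ut //; last lia.
  by rewrite addnA -ex => /Some_inj ->.
Qed.

Theorem theorem2 (R : realType) (n : nat) (hn : (45 <= n)%N) :
  CRT_W R n = RT R n /\ RT R n = n%:R / (n%:R - 1).
Proof.
have n1 : (1 < n)%N := leq_trans (isT : 1 < 45)%N hn.
have nR : 1 < n%:R :> R by rewrite ltr1n.
have lower (r : R) : (exists w : seq 'I_n, (2 * n <= size w)%N /\ word_free r w) ->
    n%:R / (n%:R - 1) <= r.
  by case=> w [wn fw]; rewrite leNgt; apply/negP => rn; exact: unavoidable fw.
have upper (r : R) : n%:R / (n%:R - 1) < r -> 1 < r.
  by move=> nr; apply: le_lt_trans nr; rewrite ler_pdivlMr ?subr_gt0 // mul1r gerBl.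
have -> : RT R n = n%:R / (n%:R - 1).
  apply: infE => [r [_ /(_ (2 * n)%N)]|r nr]; first exact: lower.
  split=> [|M]; first exact: upper.
  have [w [wM cw]] := circular_words_exist R M hn.
  by exists w; split=> //; apply: circular_free_word; exact: cw.
split=> //; apply: infE => [r [_ /(_ (2 * n)%N)[w [wn cw]]]|r nr].
  by apply: lower; exists w; split=> //; exact: circular_free_word.
split=> [|M]; first exact: upper.
have [w [wM cw]] := circular_words_exist R M hn.
by exists w; split=> //; exact: cw.
Qed.
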